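(* Let $1/2\le\sigma\le 1$ and suppose the adjacent time-step ratios satisfy $0<\gamma_{n+1}\le\gamma_{**}(\sigma)$ for $n=1,2,\dots,M-1$. Let $\phi_N^n\in X_N$ and $r^n\in\mathbb{R}$ be generated by the fully discrete scheme: for $n=1,\dots,M-1$, find $\phi_N^{n+1},\mu_N^{n+\sigma}\in X_N$ and $r^{n+1}$ such that $$(F_2^{n+\sigma}\phi_N,p_N)=-(\nabla\mu_N^{n+\sigma},\nabla p_N)\quad\forall p_N\in X_N,$$ $$(\mu_N^{n+\sigma},q_N)=\big((\Delta+\beta)\phi_N^{n+\sigma},(\Delta+\beta)q_N\big)+S(\phi_N^{n+\sigma},q_N)+\frac{r^{n+1}}{\sqrt{E_1(\phi_N^n)+C_0}}\big(F'(\phi_N^{*,n+\sigma}),q_N\big)\quad\forall q_N\in X_N,$$ $$\frac{r^{n+1}-r^n}{\tau_{n+1}}=\frac{1}{2\sqrt{E_1(\phi_N^n)+C_0}}\int_\Omega F'(\phi_N^{*,n+\sigma})\frac{\phi_N^{n+1}-\phi_N^n}{\tau_{n+1}}\,d\mathbf{x}.$$ Then for $n=1,\dots,M-1$, $$\widetilde E_N^{n+1}-\widetilde E_N^n\le 0,$$ where $$\widetilde E_N^n:=\overline E(\phi_N^n,r^n)+\frac{(2\sigma-1)\gamma_{n+1}^{3/2}}{2+2\gamma_{n+1}}\,\frac{\|\nabla^{-1}(\phi_N^n-\phi_N^{n-1})\|^2}{\tau_n}.$$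
   Context: Setting: $\Omega=(0,L)^2$ with periodic boundary conditions; $(\cdot,\cdot)$ and $\|\cdot\|$ are the $L^2(\Omega)$ inner product and norm; $X_N:=\mathrm{span}\{e^{2\pi i(kx+ly)/L}:-N\le k,l\le N\}$ (numerical solutions are real-valued). Constants: $\beta>0$, $0<\varepsilon<\beta^2$, $S\ge0$. The scheme approximates the phase field crystal equation $\phi_t=\Delta\mu$, $\mu=(\Delta+\beta)^2\phi+\phi^3-\varepsilon\phi$. Nonlinearity: $F(\phi)=\frac14\phi^4-\frac{S+\varepsilon}{2}\phi^2$ and $E_1(\phi)=\int_\Omega F(\phi)\,d\mathbf{x}$. The constant $C_0>0$ is large enough that $\frac{C_0}{2}\le E_1(\phi)+C_0\le 2C_0$ (in particular $E_1(\phi)+C_0>0$) at all functions $\phi$ at which the expression is evaluated. Also $\overline E(\phi,r):=\frac12\|(\Delta+\beta)\phi\|^2+\frac S2\|\phi\|^2+r^2$. Temporal mesh: $0=t_0<t_1<\dots<t_M=T$, $\tau_n:=t_n-t_{n-1}$ for $1\le n\le M$, and $\gamma_{n+1}:=\tau_{n+1}/\tau_n$ for $1\le n\le M-1$. Since $\gamma_{M+1}$ appears in $\widetilde E_N^M$ but is not determined by the mesh, it denotes an arbitrary fixed number in $(0,\gamma_{**}(\sigma)]$ (for $\sigma=1/2$: in $(0,\infty)$). Discrete operators: $\phi_N^{n+\sigma}:=\sigma\phi_N^{n+1}+(1-\sigma)\phi_N^n$, $\ \phi_N^{*,n+\sigma}:=\phi_N^n+\sigma\gamma_{n+1}(\phi_N^n-\phi_N^{n-1})$,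 and $$F_2^{n+\sigma}\phi_N:=\frac{1}{\tau_{n+1}}\Big[\frac{1+2\sigma\gamma_{n+1}}{1+\gamma_{n+1}}\phi_N^{n+1}-\big(1+(2\sigma-1)\gamma_{n+1}\big)\phi_N^n+\frac{(2\sigma-1)\gamma_{n+1}^2}{1+\gamma_{n+1}}\phi_N^{n-1}\Big].$$ Threshold: $G(s,z):=\frac{2+4\sigma s-(2\sigma-1)s^{3/2}}{1+s}-\frac{(2\sigma-1)z^{3/2}}{1+z}$, and $\gamma_{**}(\sigma)$ is the positive root of $G(z,z)=0$ for $\sigma\in(1/2,1]$, with $\gamma_{**}(1/2)=+\infty$ (in which case the ratio condition is just $0<\gamma_{n+1}<\infty$). Here $\gamma_{**}(1)\approx4.8645$, $\gamma_{**}$ is decreasing in $\sigma$, and $G(s,z)\ge0$ for $0<s,z\le\gamma_{**}(\sigma)$. Inverse operators: for $u\in L^2(\Omega)$ with $\int_\Omega u\,d\mathbf{x}=0$, $(-\Delta)^{-1}u=\psi$ is the periodic solution of $-\Delta\psi=u$, $\int_\Omega\psi\,d\mathbf{x}=0$, and $\|\nabla^{-1}u\|^2:=((-\Delta)^{-1}u,u)$. The starting values $\phi_N^0,\phi_N^1\in X_N$ and $r^1\in\mathbb{R}$ are given with $\int_\Omega\phi_N^1\,d\mathbf{x}=\int_\Omega\phi_N^0\,d\mathbf{x}$ (as holds when $\phi_N^1,r^1$ are computed from $\phi_N^0,r^0$ by the first-order scheme $(\frac{\phi_N^1-\phi_N^0}{\tau_1},p_N)=-(\nabla\mu_N^1,\nabla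 p_N)$, $(\mu_N^1,q_N)=((\Delta+\beta)\phi_N^1,(\Delta+\beta)q_N)+S(\phi_N^1,q_N)+\frac{r^1}{\sqrt{E_1(\phi_N^0)+C_0}}(F'(\phi_N^0),q_N)$ for all $p_N,q_N\in X_N$, $r^1-r^0=\frac{1}{2\sqrt{E_1(\phi_N^0)+C_0}}\int_\Omega F'(\phi_N^0)(\phi_N^1-\phi_N^0)\,d\mathbf{x}$). *)

(* Defs.v *)
From Stdlib Require Import Reals ZArith ClassicalEpsilon.
From Coquelicot Require Import Coquelicot.
Open Scope R_scope.

(** Functions on the torus [(0,L)^2] are represented by their periodic
    extensions, of type [R -> R -> R]. *)

(** Iterated Riemann integral over [(0,L)^2]; it is only applied to continuous
    functions, for which it is the Lebesgue integral. *)
Definition integral (L : R) (u : R -> R -> R) : R :=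
  RInt (fun x => RInt (fun y => u x y) 0 L) 0 L.

Definition inner (L : R) (u v : R -> R -> R) : R :=
  integral L (fun x y => u x y * v x y).

Definition norm_L2 (L : R) (u : R -> R -> R) : R := sqrt (inner L u u).

Definition inner_grad (L : R) (u v : R -> R -> R) : R :=
  inner L (partial_derive 1 0 u) (partial_derive 1 0 v)
  + inner L (partial_derive 0 1 u) (partial_derive 0 1 v).

Definition laplacian (u : R -> R -> R) (x y : R) : R :=
  partial_derive 2 0 u x y + partial_derive 0 2 u x y.

Definition laplacian_plus (beta : R) (u : R -> R -> R) (x y : R) : R :=
  laplacian u x y + beta * u x y.

Definition periodic2 (L : R) (u : R -> R -> R) : Prop :=
  forall x y, u (x + L) y = u x y /\ u x (y + L) = u x y.

Definition cis (theta : R) : C := (cos theta, sin theta).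

(** The real-valued elements of the span of the
    [exp (2 pi i (k x + l y) / L)], [-N <= k, l <= N]; the summation indices
    [j], [m] stand for [k + N], [l + N]. *)
Definition in_X (L : R) (N : nat) (u : R -> R -> R) : Prop :=
  exists c : Z -> Z -> C, forall x y : R,
    RtoC (u x y) =
    sum_n (fun j => sum_n (fun m =>
      let k := (Z.of_nat j - Z.of_nat N)%Z in
      let l := (Z.of_nat m - Z.of_nat N)%Z in
      Cmult (c k l) (cis (2 * PI * (IZR k * x + IZR l * y) / L)))
      (2 * N)) (2 * N).

(** [ex_diff_n psi 2 x y] at every point says that [psi] is of class C^2. *)
Definition is_inv_neg_laplacian (L : R) (u psi : R -> R -> R) : Prop :=
  (forall x y, ex_diff_n psi 2 x y) /\
  periodic2 L psi /\
  (forall x y, - laplacian psi x y = u x y) /\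
  integral L psi = 0.

(** Meaningful when [u] has zero mean and the periodic Poisson problem has a
    classical solution, in particular for zero-mean trigonometric polynomials. *)
Definition inv_neg_laplacian (L : R) (u : R -> R -> R) : R -> R -> R :=
  epsilon (inhabits (fun _ _ => 0)) (is_inv_neg_laplacian L u).

Definition norm_inv_grad_sq (L : R) (u : R -> R -> R) : R :=
  inner L (inv_neg_laplacian L u) u.

Definition F (stab eps z : R) : R := / 4 * z ^ 4 - (stab + eps) / 2 * z ^ 2.

Definition F' (stab eps : R) (u : R -> R -> R) (x y : R) : R :=
  Derive (F stab eps) (u x y).

Definition E_1 (L stab eps : R) (u : R -> R -> R) : R :=
  integral L (fun x y => F stab eps (u x y)).

Definition Ebar (L beta stab : R) (u : R -> R -> R) (r : R) : R :=
  / 2 * norm_L2 L (laplacian_plus beta u) ^ 2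
  + stab / 2 * norm_L2 L u ^ 2 + r ^ 2.

Definition tau (t : nat -> R) (n : nat) : R := t n - t (n - 1)%nat.

(** The mesh determines the ratios of index [2, ..., M]; the one of index
    [M + 1] is the free parameter [gM]. *)
Definition gamma (t : nat -> R) (M : nat) (gM : R) (n : nat) : R :=
  if Nat.eq_dec n (M + 1) then gM else tau t n / tau t (n - 1)%nat.

Definition G (sigma s z : R) : R :=
  (2 + 4 * sigma * s - (2 * sigma - 1) * Rpower s (3 / 2)) / (1 + s)
  - (2 * sigma - 1) * Rpower z (3 / 2) / (1 + z).

Definition gamma_star2 (sigma : R) : Rbar :=
  if Req_EM_T sigma (1 / 2) then p_infty
  else Finite (epsilon (inhabits 0) (fun z => 0 < z /\ G sigma z z = 0)).

Definition phi_sigma (sigma : R) (phi : nat -> R -> R -> R) (n : nat)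
    (x y : R) : R :=
  sigma * phi (n + 1)%nat x y + (1 - sigma) * phi n x y.

(** [g] and, below, [k] are the ratio and the step of index [n + 1]. *)
Definition phi_star (sigma g : R) (phi : nat -> R -> R -> R) (n : nat)
    (x y : R) : R :=
  phi n x y + sigma * g * (phi n x y - phi (n - 1)%nat x y).

Definition F2 (sigma g k : R) (phi : nat -> R -> R -> R) (n : nat)
    (x y : R) : R :=
  / k * ((1 + 2 * sigma * g) / (1 + g) * phi (n + 1)%nat x y
         - (1 + (2 * sigma - 1) * g) * phi n x y
         + (2 * sigma - 1) * g ^ 2 / (1 + g) * phi (n - 1)%nat x y).

Definition Etilde (L beta stab sigma : R) (t : nat -> R) (M : nat) (gM : R)
    (phi : nat -> R -> R -> R) (r : nat -> R) (n : nat) : R :=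
  let g := gamma t M gM (n + 1)%nat in
  Ebar L beta stab (phi n) (r n)
  + (2 * sigma - 1) * Rpower g (3 / 2) / (2 + 2 * g)
    * (norm_inv_grad_sq L (fun x y => phi n x y - phi (n - 1)%nat x y)
       / tau t n).

(* Main.v *)
Require Import Defs.
From Stdlib Require Import Reals ZArith Lia Lra FunctionalExtensionality ClassicalEpsilon.
From Coquelicot Require Import Coquelicot.
Open Scope R_scope.

(** Let [d1] and [d0] be the new and the previous increments of the numerical
    solution. Both have zero mean: this holds for the first increment by
    assumption, and testing the scheme with the constant 1 propagates it
    ([mean_increment_step]). Hence [d1] is minus the Laplacian of a
    trigonometric polynomial [psi1] of the same degree
    ([in_X_inv_neg_laplacian]), which is an admissible test function.

    Testing the first equation with [psi1] and integrating by parts ([green])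
    gives [(F2, psi1) = - (mu, d1)]. Testing the second with [d1] expresses
    [(mu, d1)] by the linear terms of the energy and by the nonlinear term,
    which the third equation identifies with [2 * r1 * (r1 - r0)]. As
    [sigma >= 1/2], the sum of these is at least the increment of [Ebar]
    ([Ebar_increment]), so that this increment is at most [- (F2, psi1)].

    It remains to bound [(F2, psi1)] from below. The difference formula is a
    combination of [d1] and [d0] only ([F2_increment]), so [(F2, psi1)] is a
    multiple of the squared dual norm of [d1] minus a multiple of the dual inner
    product of [d1] and [d0]. Young's inequality with the weight [sqrt g], where
    [g] is the ratio of the two steps, produces exactly the correction terms of
    the modified energy and a remainder [G / 2] times the squared dual norm of
    [d1] divided by the time step ([bdf2_energy_bound]). The remainder is
    nonnegative because [G] is nonnegative below its diagonal root
    ([G_nonneg]).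

    The dual norm is defined through an unspecified classical solution of the
    Poisson problem; [norm_inv_grad_sq_eq] shows that [psi1] yields the same
    value. *)

(** * Integration of continuous functions over the torus *)

Definition continuous2 (u : R -> R -> R) : Prop :=
  forall x y, continuity_2d_pt u x y.

Lemma continuous2_lincomb (a b : R) (u v : R -> R -> R) :
  continuous2 u -> continuous2 v ->
  continuous2 (fun x y => a * u x y + b * v x y).
Proof.
  intros Hu Hv x y.
  apply continuity_2d_pt_plus; apply continuity_2d_pt_mult;
    auto using continuity_2d_pt_const.
Qed.

Lemma continuous2_mult (u v : R -> R -> R) :
  continuous2 u -> continuous2 v -> continuous2 (fun x y => u x y * v x y).
Proof. intros Hu Hv x y; now apply continuity_2d_pt_mult. Qed.

Lemma continuous2_section (u : R -> R -> R) (x y : R) :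
  continuous2 u -> continuous (u x) y.
Proof.
  intros Hu. apply continuity_pt_filterlim. intros eps Heps.
  destruct (Hu x y (mkposreal eps Heps)) as [d Hd].
  exists d. split; [apply cond_pos|].
  intros z [_ Hz]. apply (Hd x z); [|exact Hz].
  rewrite Rminus_diag, Rabs_R0. apply cond_pos.
Qed.

Lemma continuous2_ex_RInt (u : R -> R -> R) (x a b : R) :
  continuous2 u -> ex_RInt (u x) a b.
Proof.
  intros Hu. apply (ex_RInt_continuous (V := R_CompleteNormedModule)).
  intros z _. now apply continuous2_section.
Qed.

(** Uniform continuity on a compact strip makes the inner integral a
    continuous function of the outer variable. *)
Lemma continuous_RInt_section (L : R) (u : R -> R -> R) (x : R) :
  0 < L -> continuous2 u -> continuous (fun x => RInt (u x) 0 L) x.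
Proof.
  intros HL Hu. apply continuity_pt_filterlim. intros eps Heps.
  assert (Hp : 0 < eps / (2 * L)) by (apply Rdiv_lt_0_compat; lra).
  destruct (uniform_continuity_2d u (x - 1) (x + 1) 0 L
              (fun x y _ _ => Hu x y) (mkposreal _ Hp)) as [d Hd].
  exists (Rmin d 1). split.
  { apply Rmin_case; [apply cond_pos | lra]. }
  intros z [_ Hz]. simpl in Hz. unfold R_dist in Hz.
  assert (Hz1 : Rabs (z - x) < d) by (eapply Rlt_le_trans; [exact Hz | apply Rmin_l]).
  assert (Hz2 : Rabs (z - x) < 1) by (eapply Rlt_le_trans; [exact Hz | apply Rmin_r]).
  apply Rabs_def2 in Hz2. simpl. unfold R_dist.
  rewrite <- (RInt_minus (V := R_CompleteNormedModule) (u z) (u x))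
    by now apply continuous2_ex_RInt.
  apply Rle_lt_trans with ((L - 0) * (eps / (2 * L))).
  - apply abs_RInt_le_const; [lra | |].
    + apply (ex_RInt_minus (V := R_NormedModule)); now apply continuous2_ex_RInt.
    + intros t Ht. apply Rlt_le. apply (Hd x t z t); try lra.
      rewrite Rminus_diag, Rabs_R0. apply cond_pos.
  - replace ((L - 0) * (eps / (2 * L))) with (eps / 2) by (field; lra). lra.
Qed.

Lemma ex_RInt_RInt_section (L : R) (u : R -> R -> R) :
  0 < L -> continuous2 u -> ex_RInt (fun x => RInt (u x) 0 L) 0 L.
Proof.
  intros HL Hu. apply (ex_RInt_continuous (V := R_CompleteNormedModule)).
  intros z _. now apply continuous_RInt_section.
Qed.

Lemma RInt_lincomb (f g : R -> R) (a b p q : R) :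
  ex_RInt f p q -> ex_RInt g p q ->
  RInt (fun x => a * f x + b * g x) p q = a * RInt f p q + b * RInt g p q.
Proof.
  intros Hf Hg. apply is_RInt_unique.
  apply (is_RInt_plus (V := R_NormedModule));
    apply (is_RInt_scal (V := R_NormedModule));
    now apply (RInt_correct (V := R_CompleteNormedModule)).
Qed.

Lemma integral_lincomb (L a b : R) (u v : R -> R -> R) :
  0 < L -> continuous2 u -> continuous2 v ->
  integral L (fun x y => a * u x y + b * v x y)
  = a * integral L u + b * integral L v.
Proof.
  intros HL Hu Hv. unfold integral.
  rewrite <- RInt_lincomb by now apply ex_RInt_RInt_section.
  apply (RInt_ext (V := R_CompleteNormedModule)). intros x _.
  apply RInt_lincomb; now apply continuous2_ex_RInt.
Qed.

Lemma integral_nonneg (L : R) (u : R -> R -> R) :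
  0 < L -> continuous2 u -> (forall x y, 0 <= u x y) -> 0 <= integral L u.
Proof.
  intros HL Hu Hpos. apply RInt_ge_0; [lra | now apply ex_RInt_RInt_section |].
  intros x _. apply RInt_ge_0; [lra | now apply continuous2_ex_RInt |].
  intros y _. apply Hpos.
Qed.

Lemma integral_const (L c : R) : integral L (fun _ _ => c) = L * (L * c).
Proof.
  unfold integral.
  rewrite (RInt_ext (V := R_CompleteNormedModule) _ (fun _ => L * c)).
  - rewrite (RInt_const (V := R_CompleteNormedModule)).
    change ((L - 0) * (L * c) = L * (L * c)). ring.
  - intros x _. rewrite (RInt_const (V := R_CompleteNormedModule)).
    change ((L - 0) * c = L * c). ring.
Qed.

Lemma inner_comm (L : R) (u v : R -> R -> R) : inner L u v = inner L v u.
Proof.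
  unfold inner. f_equal. extensionality x; extensionality y. ring.
Qed.

Lemma inner_lincomb_l (L a b : R) (u v w : R -> R -> R) :
  0 < L -> continuous2 u -> continuous2 v -> continuous2 w ->
  inner L (fun x y => a * u x y + b * v x y) w
  = a * inner L u w + b * inner L v w.
Proof.
  intros HL Hu Hv Hw. unfold inner.
  rewrite <- integral_lincomb by auto using continuous2_mult.
  f_equal. extensionality x; extensionality y. ring.
Qed.

Lemma inner_lincomb_r (L a b : R) (u v w : R -> R -> R) :
  0 < L -> continuous2 u -> continuous2 v -> continuous2 w ->
  inner L w (fun x y => a * u x y + b * v x y)
  = a * inner L w u + b * inner L w v.
Proof.
  intros. rewrite !(inner_comm L w). now apply inner_lincomb_l.
Qed.

Lemma inner_nonneg (L : R) (u : R -> R -> R) :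
  0 < L -> continuous2 u -> 0 <= inner L u u.
Proof.
  intros HL Hu. apply integral_nonneg; auto using continuous2_mult.
  intros x y. apply Rle_0_sqr.
Qed.

Lemma norm_L2_sq (L : R) (u : R -> R -> R) :
  0 < L -> continuous2 u -> norm_L2 L u ^ 2 = inner L u u.
Proof. intros HL Hu. apply pow2_sqrt. now apply inner_nonneg. Qed.

(** * Functions of class C^m and Green's identity on the torus *)

Definition class_C (m : nat) (u : R -> R -> R) : Prop :=
  forall x y, ex_diff_n u m x y.

Definition dx (u : R -> R -> R) (x y : R) : R := Derive (fun z => u z y) x.
Definition dy (u : R -> R -> R) (x y : R) : R := Derive (fun z => u x z) y.

Lemma class_C_continuous (m : nat) (u : R -> R -> R) :
  class_C m u -> continuous2 u.
Proof. intros Hu x y. specialize (Hu x y). destruct m; apply Hu. Qed.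

Lemma class_C_S (m : nat) (u : R -> R -> R) :
  class_C (S m) u <->
  continuous2 u /\
  (forall x y, ex_derive (fun z => u z y) x) /\
  (forall x y, ex_derive (fun z => u x z) y) /\
  class_C m (dx u) /\ class_C m (dy u).
Proof.
  split.
  - intros Hu. repeat split; intros x y; apply (Hu x y).
  - intros (H1 & H2 & H3 & H4 & H5) x y. simpl. repeat split; auto.
Qed.

Lemma class_C_le (m : nat) (u : R -> R -> R) :
  class_C (S m) u -> class_C m u.
Proof.
  revert u. induction m as [|m IH]; intros u Hu.
  - intros x y. split; [apply (class_C_continuous 1 u Hu) | exact I].
  - apply class_C_S in Hu. destruct Hu as (H1 & H2 & H3 & H4 & H5).
    apply class_C_S. exact (conj H1 (conj H2 (conj H3 (conj (IH _ H4) (IH _ H5))))).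
Qed.

Lemma dx_lincomb (a b : R) (u v : R -> R -> R) :
  class_C 1 u -> class_C 1 v ->
  dx (fun x y => a * u x y + b * v x y) = fun x y => a * dx u x y + b * dx v x y.
Proof.
  intros Hu Hv. apply class_C_S in Hu, Hv.
  destruct Hu as (_ & U2 & U3 & _), Hv as (_ & V2 & V3 & _).
  extensionality x; extensionality y. apply is_derive_unique.
  apply (is_derive_plus (V := R_NormedModule));
    apply is_derive_scal; apply Derive_correct; [apply U2 | apply V2].
Qed.

Lemma dy_lincomb (a b : R) (u v : R -> R -> R) :
  class_C 1 u -> class_C 1 v ->
  dy (fun x y => a * u x y + b * v x y) = fun x y => a * dy u x y + b * dy v x y.
Proof.
  intros Hu Hv. apply class_C_S in Hu, Hv.
  destruct Hu as (_ & U2 & U3 & _), Hv as (_ & V2 & V3 & _).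
  extensionality x; extensionality y. apply is_derive_unique.
  apply (is_derive_plus (V := R_NormedModule));
    apply is_derive_scal; apply Derive_correct; [apply U3 | apply V3].
Qed.

Lemma dx_mult (u v : R -> R -> R) :
  class_C 1 u -> class_C 1 v ->
  dx (fun x y => u x y * v x y) = fun x y => dx u x y * v x y + u x y * dx v x y.
Proof.
  intros Hu Hv. apply class_C_S in Hu, Hv.
  destruct Hu as (_ & U2 & U3 & _), Hv as (_ & V2 & V3 & _).
  extensionality x; extensionality y.
  exact (Derive_mult (fun z => u z y) (fun z => v z y) _ (U2 x y) (V2 x y)).
Qed.

Lemma dy_mult (u v : R -> R -> R) :
  class_C 1 u -> class_C 1 v ->
  dy (fun x y => u x y * v x y) = fun x y => dy u x y * v x y + u x y * dy v x y.
Proof.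
  intros Hu Hv. apply class_C_S in Hu, Hv.
  destruct Hu as (_ & U2 & U3 & _), Hv as (_ & V2 & V3 & _).
  extensionality x; extensionality y.
  exact (Derive_mult (fun z => u x z) (fun z => v x z) _ (U3 x y) (V3 x y)).
Qed.

Lemma class_C1_mult (u v : R -> R -> R) :
  class_C 1 u -> class_C 1 v -> class_C 1 (fun x y => u x y * v x y).
Proof.
  intros Hu Hv. apply class_C_S.
  rewrite dx_mult, dy_mult by assumption.
  pose proof (proj1 (class_C_S _ _) Hu) as (U1 & U2 & U3 & U4 & U5).
  pose proof (proj1 (class_C_S _ _) Hv) as (V1 & V2 & V3 & V4 & V5).
  apply class_C_continuous in U4, U5, V4, V5.
  repeat split.
  - now apply continuous2_mult.
  - intros x y. now apply ex_derive_mult.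
  - intros x y. now apply ex_derive_mult.
  - apply continuity_2d_pt_plus; now apply continuous2_mult.
  - apply continuity_2d_pt_plus; now apply continuous2_mult.
Qed.

Lemma class_C_lincomb (m : nat) (a b : R) (u v : R -> R -> R) :
  class_C m u -> class_C m v -> class_C m (fun x y => a * u x y + b * v x y).
Proof.
  revert u v. induction m as [|m IH]; intros u v Hu Hv.
  - intros x y. split; [|exact I].
    now apply continuous2_lincomb; apply (class_C_continuous 0).
  - assert (HS : forall w, class_C (S m) w -> class_C 1 w).
    { clear. induction m as [|m IH]; auto using class_C_le. }
    apply class_C_S. rewrite dx_lincomb, dy_lincomb by auto.
    apply class_C_S in Hu, Hv.
    destruct Hu as (U1 & U2 & U3 & U4 & U5), Hv as (V1 & V2 & V3 & V4 & V5).
    refine (conj (continuous2_lincomb a b u v U1 V1) (conj _ (conj _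
              (conj (IH _ _ U4 V4) (IH _ _ U5 V5))))); intros x y;
      apply (ex_derive_plus (V := R_NormedModule)); now apply ex_derive_scal.
Qed.

Lemma laplacian_dx_dy (u : R -> R -> R) (x y : R) :
  laplacian u x y = dx (dx u) x y + dy (dy u) x y.
Proof. reflexivity. Qed.

Lemma inner_grad_dx_dy (L : R) (u v : R -> R -> R) :
  inner_grad L u v = inner L (dx u) (dx v) + inner L (dy u) (dy v).
Proof. reflexivity. Qed.

Lemma laplacian_lincomb (a b : R) (u v : R -> R -> R) :
  class_C 2 u -> class_C 2 v ->
  laplacian (fun x y => a * u x y + b * v x y)
  = fun x y => a * laplacian u x y + b * laplacian v x y.
Proof.
  intros Hu Hv. extensionality x; extensionality y.
  rewrite !laplacian_dx_dy.
  rewrite dx_lincomb, dy_lincomb by auto using class_C_le.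
  apply class_C_S in Hu, Hv.
  rewrite dx_lincomb, dy_lincomb by (apply Hu || apply Hv).
  ring.
Qed.

Lemma laplacian_continuous (u : R -> R -> R) :
  class_C 2 u -> continuous2 (laplacian u).
Proof.
  intros Hu x y. apply class_C_S in Hu. destruct Hu as (_ & _ & _ & H4 & H5).
  apply class_C_S in H4, H5.
  apply (continuity_2d_pt_plus (dx (dx u)) (dy (dy u)));
    apply (class_C_continuous 0); [apply H4 | apply H5].
Qed.

(** [Derive] is defined through the difference quotients, which inherit the
    period. *)
Lemma periodic2_dx (L : R) (u : R -> R -> R) :
  periodic2 L u -> periodic2 L (dx u).
Proof.
  intros Hp x y. unfold dx, Derive. split; do 2 f_equal; extensionality h.
  - replace (x + L + h) with ((x + h) + L) by ring.
    now rewrite !(proj1 (Hp _ _)).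
  - now rewrite !(proj2 (Hp _ _)).
Qed.

Lemma periodic2_dy (L : R) (u : R -> R -> R) :
  periodic2 L u -> periodic2 L (dy u).
Proof.
  intros Hp x y. unfold dy, Derive. split; do 2 f_equal; extensionality h.
  - now rewrite !(proj1 (Hp _ _)).
  - replace (y + L + h) with ((y + h) + L) by ring.
    now rewrite !(proj2 (Hp _ _)).
Qed.

Lemma periodic2_lincomb (L a b : R) (u v : R -> R -> R) :
  periodic2 L u -> periodic2 L v -> periodic2 L (fun x y => a * u x y + b * v x y).
Proof.
  intros Hu Hv x y. destruct (Hu x y), (Hv x y). split; congruence.
Qed.

Lemma periodic2_mult (L : R) (u v : R -> R -> R) :
  periodic2 L u -> periodic2 L v -> periodic2 L (fun x y => u x y * v x y).
Proof.
  intros Hu Hv x y. destruct (Hu x y), (Hv x y). split; congruence.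
Qed.

Lemma integral_dy (L : R) (u : R -> R -> R) :
  0 < L -> class_C 1 u -> periodic2 L u -> integral L (dy u) = 0.
Proof.
  intros HL Hu Hp. apply class_C_S in Hu. destruct Hu as (_ & _ & H3 & _ & H5).
  apply class_C_continuous in H5.
  unfold integral.
  rewrite (RInt_ext (V := R_CompleteNormedModule) _ (fun _ => 0)).
  - rewrite (RInt_const (V := R_CompleteNormedModule)).
    change ((L - 0) * 0 = 0). ring.
  - intros x _. unfold dy. change (RInt (Derive (u x)) 0 L = 0).
    rewrite RInt_Derive.
    + rewrite <- (Rplus_0_l L), (proj2 (Hp x 0)). exact (Rminus_diag _).
    + intros y _. apply H3.
    + intros y _. now apply (continuous2_section (dy u)).
Qed.

(** The inner integral in [y] cannot be evaluated by the fundamental theorem of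
    calculus here. Differentiation under the integral sign shows instead that
    it is the derivative in [x] of the inner integral of [u], which is periodic
    in [x]. *)
Lemma integral_dx (L : R) (u : R -> R -> R) :
  0 < L -> class_C 1 u -> periodic2 L u -> integral L (dx u) = 0.
Proof.
  intros HL Hu Hp. apply class_C_S in Hu. destruct Hu as (H1 & H2 & _ & H4 & _).
  apply class_C_continuous in H4.
  assert (HD : forall x, is_derive (fun x => RInt (u x) 0 L) x
                                   (RInt (dx u x) 0 L)).
  { intros x. apply (is_derive_RInt_param u 0 L x).
    - exists (mkposreal 1 Rlt_0_1). intros z _ y _. apply H2.
    - intros y _. apply H4.
    - exists (mkposreal 1 Rlt_0_1). intros z _. now apply continuous2_ex_RInt. }
  unfold integral.
  rewrite (is_RInt_unique _ 0 L (RInt (u L) 0 L - RInt (u 0) 0 L)).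
  - rewrite (RInt_ext (V := R_CompleteNormedModule) (u L) (u 0)).
    + ring.
    + intros y _. rewrite <- (Rplus_0_l L) at 1. apply Hp.
  - apply (is_RInt_derive (fun x => RInt (u x) 0 L)).
    + intros x _. apply HD.
    + intros x _. now apply (continuous_RInt_section L (dx u)).
Qed.

(** The product rule writes the difference of the two sides as the integral of the
    divergence of the periodic field [u * grad v]. *)
Lemma green (L : R) (u v : R -> R -> R) :
  0 < L -> class_C 1 u -> class_C 2 v -> periodic2 L u -> periodic2 L v ->
  inner_grad L u v = - inner L u (laplacian v).
Proof.
  intros HL Hu Hv Pu Pv.
  pose proof (proj1 (class_C_S _ _) Hu) as (_ & _ & _ & U4 & U5).
  pose proof (proj1 (class_C_S _ _) Hv) as (_ & _ & _ & V4 & V5).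
  pose proof (integral_dx L _ HL (class_C1_mult _ _ Hu V4)
                (periodic2_mult _ _ _ Pu (periodic2_dx _ _ Pv))) as Ix.
  pose proof (integral_dy L _ HL (class_C1_mult _ _ Hu V5)
                (periodic2_mult _ _ _ Pu (periodic2_dy _ _ Pv))) as Iy.
  rewrite dx_mult in Ix by assumption. rewrite dy_mult in Iy by assumption.
  pose proof (class_C_continuous _ _ Hu) as U0.
  pose proof (class_C_continuous _ _ U4) as U4c.
  pose proof (class_C_continuous _ _ U5) as U5c.
  pose proof (class_C_continuous _ _ V4) as V4c.
  pose proof (class_C_continuous _ _ V5) as V5c.
  apply class_C_S in V4, V5.
  assert (V4d : continuous2 (dx (dx v))) by (apply (class_C_continuous 0); apply V4).
  assert (V5d : continuous2 (dy (dy v))) by (apply (class_C_continuous 0); apply V5).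
  pose proof (integral_lincomb L 1 1 (fun x y => dx u x y * dx v x y)
                (fun x y => u x y * dx (dx v) x y) HL
                ltac:(auto using continuous2_mult)
                ltac:(auto using continuous2_mult)) as Jx.
  pose proof (integral_lincomb L 1 1 (fun x y => dy u x y * dy v x y)
                (fun x y => u x y * dy (dy v) x y) HL
                ltac:(auto using continuous2_mult)
                ltac:(auto using continuous2_mult)) as Jy.
  assert (Jl : inner L u (laplacian v)
               = 1 * inner L u (dx (dx v)) + 1 * inner L u (dy (dy v))).
  { rewrite <- inner_lincomb_r by assumption. f_equal.
    extensionality x; extensionality y. rewrite laplacian_dx_dy. ring. }
  rewrite inner_grad_dx_dy, Jl. unfold inner.
  replace (fun x y => dx u x y * dx v x y + u x y * dx (dx v) x y)
    with (fun x y => 1 * (dx u x y * dx v x y) + 1 * (u x y * dx (dx v) x y)) in Ix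
    by (extensionality x; extensionality y; ring).
  replace (fun x y => dy u x y * dy v x y + u x y * dy (dy v) x y)
    with (fun x y => 1 * (dy u x y * dy v x y) + 1 * (u x y * dy (dy v) x y)) in Iy
    by (extensionality x; extensionality y; ring).
  lra.
Qed.

Lemma inner_grad_comm (L : R) (u v : R -> R -> R) :
  inner_grad L u v = inner_grad L v u.
Proof.
  rewrite !inner_grad_dx_dy. now rewrite (inner_comm L (dx u)), (inner_comm L (dy u)).
Qed.

Lemma inner_laplacian_comm (L : R) (u v : R -> R -> R) :
  0 < L -> class_C 2 u -> class_C 2 v -> periodic2 L u -> periodic2 L v ->
  inner L u (laplacian v) = inner L v (laplacian u).
Proof.
  intros HL Hu Hv Pu Pv.
  pose proof (green L u v HL (class_C_le _ _ Hu) Hv Pu Pv) as E1.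
  pose proof (green L v u HL (class_C_le _ _ Hv) Hu Pv Pu) as E2.
  rewrite inner_grad_comm in E2. lra.
Qed.

Lemma inner_laplacian_nonpos (L : R) (u : R -> R -> R) :
  0 < L -> class_C 2 u -> periodic2 L u -> inner L u (laplacian u) <= 0.
Proof.
  intros HL Hu Pu.
  pose proof (green L u u HL (class_C_le _ _ Hu) Hu Pu Pu) as E.
  apply class_C_S in Hu. destruct Hu as (_ & _ & _ & H4 & H5).
  rewrite inner_grad_dx_dy in E.
  pose proof (inner_nonneg L (dx u) HL (class_C_continuous _ _ H4)).
  pose proof (inner_nonneg L (dy u) HL (class_C_continuous _ _ H5)).
  lra.
Qed.

(** This is used both to see that the mean of the solution is conserved and to
    compute means of trigonometric polynomials without evaluating any integral
    of a sine or cosine. *)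
Lemma integral_laplacian (L : R) (u : R -> R -> R) :
  0 < L -> class_C 2 u -> periodic2 L u -> integral L (laplacian u) = 0.
Proof.
  intros HL Hu Pu. apply class_C_S in Hu. destruct Hu as (_ & _ & _ & H4 & H5).
  pose proof (integral_dx L _ HL H4 (periodic2_dx _ _ Pu)) as Ix.
  pose proof (integral_dy L _ HL H5 (periodic2_dy _ _ Pu)) as Iy.
  apply class_C_S in H4, H5.
  replace (laplacian u) with (fun x y => 1 * dx (dx u) x y + 1 * dy (dy u) x y)
    by (extensionality x; extensionality y; rewrite laplacian_dx_dy; ring).
  rewrite integral_lincomb, Ix, Iy; [ring | exact HL | |];
    apply (class_C_continuous 0); [apply H4 | apply H5].
Qed.

(** * Real trigonometric polynomials *)

Definition sum2 (N : nat) (f : Z -> Z -> R) : R :=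
  sum_n (fun j => sum_n (fun m =>
    f (Z.of_nat j - Z.of_nat N)%Z (Z.of_nat m - Z.of_nat N)%Z) (2 * N)) (2 * N).

Definition phase (L : R) (k l : Z) (x y : R) : R :=
  2 * PI * (IZR k * x + IZR l * y) / L.

(** The real part of the trigonometric sum with complex coefficients
    [a k l + i b k l]. In this form differentiation acts on the coefficients
    alone. *)
Definition trig (L : R) (N : nat) (a b : Z -> Z -> R) (x y : R) : R :=
  sum2 N (fun k l => a k l * cos (phase L k l x y) - b k l * sin (phase L k l x y)).

Lemma sum_n_lincomb (f g : nat -> R) (a b : R) (n : nat) :
  sum_n (fun i => a * f i + b * g i) n = a * sum_n f n + b * sum_n g n.
Proof.
  rewrite (sum_n_plus (G := R_AbelianMonoid) (fun i => a * f i) (fun i => b * g i)).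
  rewrite (sum_n_mult_l (K := R_Ring) a f), (sum_n_mult_l (K := R_Ring) b g).
  reflexivity.
Qed.

Lemma sum2_ext (N : nat) (f g : Z -> Z -> R) :
  (forall k l, f k l = g k l) -> sum2 N f = sum2 N g.
Proof.
  intros H. f_equal. extensionality k; extensionality l. apply H.
Qed.

Lemma sum2_lincomb (N : nat) (f g : Z -> Z -> R) (a b : R) :
  sum2 N (fun k l => a * f k l + b * g k l) = a * sum2 N f + b * sum2 N g.
Proof.
  unfold sum2. rewrite <- sum_n_lincomb.
  apply sum_n_ext; intros j. apply sum_n_lincomb.
Qed.

Lemma sum_n_rev (f : nat -> R) (n : nat) :
  sum_n (fun i => f (n - i)%nat) n = sum_n f n.
Proof.
  revert f. induction n as [|n IH]; intros f.
  - now rewrite !sum_O.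
  - rewrite sum_Sn, Nat.sub_diag.
    rewrite (sum_n_ext_loc _ (fun i => f (S (n - i)))) by
      (intros i Hi; f_equal; lia).
    rewrite (IH (fun i => f (S i))).
    unfold sum_n. rewrite (sum_Sn_m f 0 (S n)) by lia.
    rewrite (sum_n_m_S f 0 n). apply Rplus_comm.
Qed.

Lemma sum2_opp (N : nat) (f : Z -> Z -> R) :
  sum2 N (fun k l => f (- k)%Z (- l)%Z) = sum2 N f.
Proof.
  unfold sum2. etransitivity; [|apply sum_n_rev].
  apply sum_n_ext_loc; intros j Hj. cbv beta.
  etransitivity; [|apply sum_n_rev].
  apply sum_n_ext_loc; intros m Hm. f_equal; lia.
Qed.

Lemma sum2_kronecker (N : nat) :
  sum2 N (fun k l => if Z.eq_dec k 0 then if Z.eq_dec l 0 then 1 else 0 else 0) = 1.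
Proof.
  assert (K : forall v n i, (i <= n)%nat ->
            sum_n (fun j => if Nat.eq_dec j i then v else 0) n = v).
  { intros v n i. induction n as [|n IH]; intros Hi.
    - rewrite sum_O. destruct (Nat.eq_dec 0 i); [reflexivity | lia].
    - rewrite sum_Sn. destruct (Nat.eq_dec (S n) i) as [E|E].
      + rewrite (sum_n_ext_loc _ (fun _ => 0)).
        * rewrite sum_n_const. change (INR (S n) * 0 + v = v). ring.
        * intros j Hj. destruct (Nat.eq_dec j i); [lia | reflexivity].
      + rewrite IH by lia. apply Rplus_0_r. }
  unfold sum2. etransitivity; [|apply (K 1 (2 * N)%nat N); lia].
  apply sum_n_ext; intros j.
  destruct (Z.eq_dec (Z.of_nat j - Z.of_nat N) 0) as [Ej|Ej],
           (Nat.eq_dec j N) as [Ej'|Ej']; try lia.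
  - etransitivity; [|apply (K 1 (2 * N)%nat N); lia].
    apply sum_n_ext; intros m.
    destruct (Z.eq_dec (Z.of_nat m - Z.of_nat N) 0), (Nat.eq_dec m N);
      reflexivity || lia.
  - rewrite sum_n_const. apply Rmult_0_r.
Qed.

Lemma is_derive_sum2 (N : nat) (f : Z -> Z -> R -> R) (d : Z -> Z -> R) (x : R) :
  (forall k l, is_derive (f k l) x (d k l)) ->
  is_derive (fun z => sum2 N (fun k l => f k l z)) x (sum2 N d).
Proof.
  intros H. unfold sum2.
  apply (is_derive_sum_n (V := R_NormedModule)
           (fun j z => sum_n (fun m => f (Z.of_nat j - Z.of_nat N)%Z
                                         (Z.of_nat m - Z.of_nat N)%Z z) (2 * N))).
  intros j _.
  apply (is_derive_sum_n (V := R_NormedModule)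
           (fun m => f (Z.of_nat j - Z.of_nat N)%Z (Z.of_nat m - Z.of_nat N)%Z)).
  intros m _. apply H.
Qed.

Lemma continuous2_sum_n (f : nat -> R -> R -> R) (n : nat) :
  (forall i, continuous2 (f i)) ->
  continuous2 (fun x y => sum_n (fun i => f i x y) n).
Proof.
  intros H. induction n as [|n IH]; intros x y.
  - apply (continuity_2d_pt_ext (f 0%nat)); [|apply H].
    intros; now rewrite sum_O.
  - apply (continuity_2d_pt_ext
             (fun x y => sum_n (fun i => f i x y) n + f (S n) x y)).
    + intros; now rewrite sum_Sn.
    + apply continuity_2d_pt_plus; [apply IH | apply H].
Qed.

Lemma trig_lincomb (L : R) (N : nat) (p q : R) (a b a' b' : Z -> Z -> R) :
  (fun x y => p * trig L N a b x y + q * trig L N a' b' x y)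
  = trig L N (fun k l => p * a k l + q * a' k l) (fun k l => p * b k l + q * b' k l).
Proof.
  extensionality x; extensionality y. unfold trig. rewrite <- sum2_lincomb.
  apply sum2_ext; intros k l. ring.
Qed.

Lemma trig_continuous (L : R) (N : nat) (a b : Z -> Z -> R) :
  continuous2 (trig L N a b).
Proof.
  unfold trig, sum2.
  apply (continuous2_sum_n (fun j x y => sum_n (fun m => _) (2 * N))); intros j.
  apply (continuous2_sum_n (fun m x y => _)); intros m x y. cbv beta.
  set (k := (Z.of_nat j - Z.of_nat N)%Z). set (l := (Z.of_nat m - Z.of_nat N)%Z).
  assert (Hp : continuity_2d_pt (phase L k l) x y).
  { unfold phase, Rdiv. repeat first
      [ apply continuity_2d_pt_mult | apply continuity_2d_pt_plus
      | apply continuity_2d_pt_const | apply continuity_2d_pt_id1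
      | apply continuity_2d_pt_id2 ]. }
  apply continuity_2d_pt_minus; apply continuity_2d_pt_mult;
    try apply continuity_2d_pt_const; apply continuity_1d_2d_pt_comp; auto.
  - apply continuity_cos.
  - apply continuity_sin.
Qed.

Lemma is_derive_trig_x (L : R) (N : nat) (a b : Z -> Z -> R) (x y : R) :
  is_derive (fun z => trig L N a b z y) x
    (trig L N (fun k l => - (2 * PI / L * IZR k) * b k l)
              (fun k l => 2 * PI / L * IZR k * a k l) x y).
Proof.
  apply (is_derive_sum2 N (fun k l z => a k l * cos (phase L k l z y)
                                        - b k l * sin (phase L k l z y))).
  intros k l. unfold phase, Rdiv. auto_derive; [easy | ring].
Qed.

Lemma is_derive_trig_y (L : R) (N : nat) (a b : Z -> Z -> R) (x y : R) :
  is_derive (fun z => trig L N a b x z) y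
    (trig L N (fun k l => - (2 * PI / L * IZR l) * b k l)
              (fun k l => 2 * PI / L * IZR l * a k l) x y).
Proof.
  apply (is_derive_sum2 N (fun k l z => a k l * cos (phase L k l x z)
                                        - b k l * sin (phase L k l x z))).
  intros k l. unfold phase, Rdiv. auto_derive; [easy | ring].
Qed.

Lemma dx_trig (L : R) (N : nat) (a b : Z -> Z -> R) :
  dx (trig L N a b)
  = trig L N (fun k l => - (2 * PI / L * IZR k) * b k l)
             (fun k l => 2 * PI / L * IZR k * a k l).
Proof.
  extensionality x; extensionality y. apply is_derive_unique, is_derive_trig_x.
Qed.

Lemma dy_trig (L : R) (N : nat) (a b : Z -> Z -> R) :
  dy (trig L N a b)
  = trig L N (fun k l => - (2 * PI / L * IZR l) * b k l)
             (fun k l => 2 * PI / L * IZR l * a k l).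
Proof.
  extensionality x; extensionality y. apply is_derive_unique, is_derive_trig_y.
Qed.

(** Trigonometric sums are continuous, and their partial derivatives are again
    trigonometric sums. *)
Lemma trig_class_C (L : R) (N m : nat) (a b : Z -> Z -> R) :
  class_C m (trig L N a b).
Proof.
  revert a b. induction m as [|m IH]; intros a b.
  - intros x y. split; [apply trig_continuous | exact I].
  - apply class_C_S. rewrite dx_trig, dy_trig.
    refine (conj (trig_continuous _ _ _ _) (conj _ (conj _ (conj (IH _ _) (IH _ _)))));
      intros x y; eexists; [apply is_derive_trig_x | apply is_derive_trig_y].
Qed.

Definition eigenvalue (L : R) (k l : Z) : R :=
  (2 * PI / L) ^ 2 * (IZR k ^ 2 + IZR l ^ 2).

Lemma laplacian_trig (L : R) (N : nat) (a b : Z -> Z -> R) :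
  laplacian (trig L N a b)
  = trig L N (fun k l => - eigenvalue L k l * a k l)
             (fun k l => - eigenvalue L k l * b k l).
Proof.
  transitivity (fun x y => 1 * dx (dx (trig L N a b)) x y
                           + 1 * dy (dy (trig L N a b)) x y).
  - extensionality x; extensionality y. rewrite laplacian_dx_dy. ring.
  - rewrite dx_trig, dx_trig, dy_trig, dy_trig, trig_lincomb.
    f_equal; extensionality k; extensionality l; unfold eigenvalue; ring.
Qed.

Lemma periodic_Z (f : R -> R) (p : R) (k : Z) (x : R) :
  (forall x, f (x + p) = f x) -> f (x + IZR k * p) = f x.
Proof.
  intros H.
  assert (Hn : forall n x, f (x + INR n * p) = f x).
  { induction n as [|n IH]; intros z.
    - f_equal. simpl. ring.
    - rewrite S_INR, <- (IH z), <- (H (z + INR n * p)). f_equal. ring. }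
  destruct (Z_le_gt_dec 0 k) as [Hk|Hk].
  - rewrite <- (Z2Nat.id k Hk), <- INR_IZR_INZ. apply Hn.
  - rewrite <- (Hn (Z.to_nat (- k)) (x + IZR k * p)).
    rewrite INR_IZR_INZ, Z2Nat.id, opp_IZR by lia. f_equal. ring.
Qed.

Lemma trig_periodic (L : R) (N : nat) (a b : Z -> Z -> R) :
  L <> 0 -> periodic2 L (trig L N a b).
Proof.
  intros HL.
  assert (Hc : forall k x, cos (x + IZR k * (2 * PI)) = cos x).
  { intros k x. apply periodic_Z. intros z.
    rewrite cos_plus, cos_2PI, sin_2PI. ring. }
  assert (Hs : forall k x, sin (x + IZR k * (2 * PI)) = sin x).
  { intros k x. apply periodic_Z. intros z.
    rewrite sin_plus, cos_2PI, sin_2PI. ring. }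
  intros x y. split; apply sum2_ext; intros k l.
  - replace (phase L k l (x + L) y) with (phase L k l x y + IZR k * (2 * PI))
      by (unfold phase; field; exact HL).
    now rewrite Hc, Hs.
  - replace (phase L k l x (y + L)) with (phase L k l x y + IZR l * (2 * PI))
      by (unfold phase; field; exact HL).
    now rewrite Hc, Hs.
Qed.


Lemma fst_sum_n (f : nat -> C) (n : nat) :
  fst (sum_n f n) = sum_n (fun i => fst (f i)) n.
Proof.
  induction n as [|n IH]; [now rewrite !sum_O|].
  rewrite !sum_Sn, <- IH. reflexivity.
Qed.

Lemma snd_sum_n (f : nat -> C) (n : nat) :
  snd (sum_n f n) = sum_n (fun i => snd (f i)) n.
Proof.
  induction n as [|n IH]; [now rewrite !sum_O|].
  rewrite !sum_Sn, <- IH. reflexivity.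
Qed.

Lemma in_X_trig (L : R) (N : nat) (u : R -> R -> R) :
  in_X L N u -> exists a b, u = trig L N a b.
Proof.
  intros [c Hc].
  exists (fun k l => fst (c k l)), (fun k l => snd (c k l)).
  extensionality x; extensionality y.
  change (u x y) with (fst (RtoC (u x y))). rewrite Hc, fst_sum_n.
  apply sum_n_ext; intros j. rewrite fst_sum_n. reflexivity.
Qed.

(** Averaging the coefficient of a wave vector with the conjugate of the
    coefficient of its opposite leaves the real part of the sum unchanged and
    makes its imaginary part vanish. *)
Lemma trig_in_X (L : R) (N : nat) (a b : Z -> Z -> R) :
  in_X L N (trig L N a b).
Proof.
  exists (fun k l => (/ 2 * a k l + / 2 * a (- k)%Z (- l)%Z,
                      / 2 * b k l - / 2 * b (- k)%Z (- l)%Z)).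
  intros x y.
  assert (Ho : forall k l, phase L (- k) (- l) x y = - phase L k l x y).
  { intros k l. unfold phase, Rdiv. rewrite !opp_IZR. ring. }
  set (re := fun k l => a k l * cos (phase L k l x y) - b k l * sin (phase L k l x y)).
  set (im := fun k l => a k l * sin (phase L k l x y) + b k l * cos (phase L k l x y)).
  apply injective_projections.
  - rewrite fst_sum_n.
    transitivity (sum2 N (fun k l => / 2 * re k l + / 2 * re (- k)%Z (- l)%Z)).
    + rewrite (sum2_lincomb N re (fun k l => re (- k)%Z (- l)%Z)), (sum2_opp N re).
      change (sum2 N re = / 2 * sum2 N re + / 2 * sum2 N re). field.
    + apply sum_n_ext; intros j. rewrite fst_sum_n.
      apply sum_n_ext; intros m. cbv zeta. unfold re, cis. rewrite Ho, cos_neg, sin_neg.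
      unfold phase. simpl fst. simpl snd.
      change (@eq _ ?p ?q) with (@eq R p q). ring.
  - rewrite snd_sum_n.
    transitivity (sum2 N (fun k l => / 2 * im k l + (- / 2) * im (- k)%Z (- l)%Z)).
    + rewrite (sum2_lincomb N im (fun k l => im (- k)%Z (- l)%Z)), (sum2_opp N im).
      change (0 = / 2 * sum2 N im + - / 2 * sum2 N im). field.
    + apply sum_n_ext; intros j. rewrite snd_sum_n.
      apply sum_n_ext; intros m. cbv zeta. unfold im, cis. rewrite Ho, cos_neg, sin_neg.
      unfold phase. simpl fst. simpl snd.
      change (@eq _ ?p ?q) with (@eq R p q). ring.
Qed.

Lemma in_X_lincomb (L : R) (N : nat) (p q : R) (u v : R -> R -> R) :
  in_X L N u -> in_X L N v -> in_X L N (fun x y => p * u x y + q * v x y).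
Proof.
  intros Hu Hv.
  destruct (in_X_trig _ _ _ Hu) as (a & b & ->).
  destruct (in_X_trig _ _ _ Hv) as (a' & b' & ->).
  rewrite trig_lincomb. apply trig_in_X.
Qed.

Lemma in_X_class_C (L : R) (N m : nat) (u : R -> R -> R) :
  in_X L N u -> class_C m u.
Proof.
  intros Hu. destruct (in_X_trig _ _ _ Hu) as (a & b & ->). apply trig_class_C.
Qed.

Lemma in_X_continuous (L : R) (N : nat) (u : R -> R -> R) :
  in_X L N u -> continuous2 u.
Proof. intros Hu. exact (class_C_continuous 0 u (in_X_class_C L N 0 u Hu)). Qed.

Lemma in_X_periodic (L : R) (N : nat) (u : R -> R -> R) :
  L <> 0 -> in_X L N u -> periodic2 L u.
Proof.
  intros HL Hu. destruct (in_X_trig _ _ _ Hu) as (a & b & ->).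
  now apply trig_periodic.
Qed.

(** The test function [1] extracts the mean value from the first equation of
    the scheme. *)
Lemma in_X_one (L : R) (N : nat) : in_X L N (fun _ _ => 1).
Proof.
  replace (fun _ _ : R => 1) with
    (trig L N (fun k l => if Z.eq_dec k 0 then if Z.eq_dec l 0 then 1 else 0 else 0)
              (fun _ _ => 0)).
  - apply trig_in_X.
  - extensionality x; extensionality y.
    etransitivity; [|apply (sum2_kronecker N)]. apply sum2_ext; intros k l.
    destruct (Z.eq_dec k 0) as [->|]; [destruct (Z.eq_dec l 0) as [->|]|];
      try ring.
    replace (phase L 0 0 x y) with 0 by (unfold phase, Rdiv; ring).
    rewrite cos_0. ring.
Qed.

(** * Inverting the Laplacian on trigonometric polynomials of zero mean *)

Lemma eigenvalue_neq_0 (L : R) (k l : Z) :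
  0 < L -> ~ (k = 0 /\ l = 0)%Z -> eigenvalue L k l <> 0.
Proof.
  intros HL Hkl. unfold eigenvalue.
  assert (Hw : 2 * PI / L <> 0).
  { apply Rgt_not_eq, Rdiv_lt_0_compat; [pose proof PI_RGT_0; lra | exact HL]. }
  apply Rmult_integral_contrapositive_currified; [now apply pow_nonzero|].
  intros E. apply Hkl.
  split; apply eq_IZR; nra.
Qed.

(** At the zero frequency the eigenvalue is 0, but the quotient is 0 divided by
    0 and its product with the eigenvalue is still the coefficient 0. *)
Lemma trig_eq_laplacian (L : R) (N : nat) (a b : Z -> Z -> R) :
  0 < L -> a 0%Z 0%Z = 0 -> b 0%Z 0%Z = 0 ->
  laplacian (trig L N (fun k l => - (a k l / eigenvalue L k l))
                      (fun k l => - (b k l / eigenvalue L k l)))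
  = trig L N a b.
Proof.
  intros HL Ha Hb. rewrite laplacian_trig.
  assert (H : forall c : Z -> Z -> R, c 0%Z 0%Z = 0 ->
            (fun k l => - eigenvalue L k l * - (c k l / eigenvalue L k l)) = c).
  { intros c Hc. extensionality k; extensionality l.
    destruct (Z.eq_dec k 0) as [->|Hk]; [destruct (Z.eq_dec l 0) as [->|Hl]|].
    - rewrite Hc. unfold Rdiv. ring.
    - field. apply eigenvalue_neq_0; tauto.
    - field. apply eigenvalue_neq_0; tauto. }
  now rewrite !H.
Qed.

(** Dividing the coefficients by the eigenvalues solves the equation once the
    zero-frequency term has been removed from [u]. That term is a constant, and
    its mean is that of [u] minus that of a Laplacian, so it vanishes. The
    solution has zero mean because it is a Laplacian in its turn. *)
Lemma in_X_inv_neg_laplacian (L : R) (N : nat) (u : R -> R -> R) :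
  0 < L -> in_X L N u -> integral L u = 0 ->
  exists psi, in_X L N psi /\ is_inv_neg_laplacian L u psi.
Proof.
  intros HL Hu Hmean.
  destruct (in_X_trig _ _ _ Hu) as (a & b & ->).
  set (nz := fun (c : Z -> Z -> R) k l =>
    if Z.eq_dec k 0 then if Z.eq_dec l 0 then 0 else c k l else c k l).
  set (inv := fun (c : Z -> Z -> R) k l => c k l / eigenvalue L k l).
  set (psi := trig L N (inv (nz a)) (inv (nz b))).
  assert (Hlap : laplacian (trig L N (fun k l => - inv (nz a) k l)
                                     (fun k l => - inv (nz b) k l))
                 = trig L N (nz a) (nz b)).
  { now apply trig_eq_laplacian. }
  assert (HL0 : L <> 0) by lra.
  assert (M0 : integral L (trig L N (nz a) (nz b)) = 0).
  { rewrite <- Hlap. apply integral_laplacian;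
      auto using trig_class_C, trig_periodic. }
  assert (Mpsi : integral L psi = 0).
  { unfold psi. rewrite <- (trig_eq_laplacian L N (inv (nz a)) (inv (nz b)) HL)
      by (unfold inv, nz, Rdiv; simpl; ring).
    apply integral_laplacian; auto using trig_class_C, trig_periodic. }
  assert (Hu0 : trig L N a b = trig L N (nz a) (nz b)).
  { set (d := fun x y => 1 * trig L N a b x y + (-1) * trig L N (nz a) (nz b) x y).
    assert (Hd : d = fun _ _ => d 0 0).
    { assert (Hdt := trig_lincomb L N 1 (-1) a b (nz a) (nz b)).
      fold d in Hdt. rewrite Hdt.
      extensionality x; extensionality y. apply sum2_ext; intros k l. unfold nz.
      destruct (Z.eq_dec k 0) as [->|Hk]; [destruct (Z.eq_dec l 0) as [->|Hl]|];
        try ring.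
      replace (phase L 0 0 x y) with (phase L 0 0 0 0)
        by (unfold phase, Rdiv; ring).
      reflexivity. }
    assert (Id : integral L d = 0).
    { unfold d. rewrite integral_lincomb by auto using trig_continuous.
      rewrite Hmean, M0. ring. }
    rewrite Hd, integral_const in Id.
    assert (Hd0 : d 0 0 = 0).
    { destruct (Rmult_integral _ _ Id) as [?|Id']; [lra|].
      destruct (Rmult_integral _ _ Id'); lra. }
    extensionality x; extensionality y.
    assert (Hxy : d x y = 0) by now rewrite Hd.
    unfold d in Hxy. lra. }
  exists psi. split; [apply trig_in_X|].
  split; [apply trig_class_C|]. split; [now apply trig_periodic|].
  split; [|exact Mpsi].
  intros x y. rewrite Hu0, <- Hlap. unfold psi. rewrite !laplacian_trig.
  transitivity ((-1) * trig L N (fun k l => - eigenvalue L k l * inv (nz a) k l)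
                  (fun k l => - eigenvalue L k l * inv (nz b) k l) x y
                + 0 * trig L N a b x y); [ring|].
  etransitivity; [exact (f_equal (fun f => f x y) (trig_lincomb L N _ _ _ _ _ _))|].
  f_equal; extensionality k; extensionality l; ring.
Qed.

Lemma inner_inv_neg_laplacian (L : R) (u psi v : R -> R -> R) :
  0 < L -> is_inv_neg_laplacian L u psi -> continuous2 v ->
  inner L v u = - inner L v (laplacian psi).
Proof.
  intros HL (P1 & _ & P3 & _) Hv.
  replace u with (fun x y => (-1) * laplacian psi x y + 0 * laplacian psi x y)
    by (extensionality x; extensionality y; rewrite <- P3; ring).
  rewrite inner_lincomb_r by auto using laplacian_continuous. ring.
Qed.

(** The inverse Laplacian in the dual norm is some periodic solution of class
    C^2 chosen by [epsilon], about which nothing else is known. Since the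
    Laplacian is symmetric, every solution gives the same value, and one may
    take the solution [psi] that belongs to the trigonometric space and can be
    used as a test function. *)
Lemma norm_inv_grad_sq_eq (L : R) (u psi : R -> R -> R) :
  0 < L -> is_inv_neg_laplacian L u psi -> norm_inv_grad_sq L u = inner L u psi.
Proof.
  intros HL Hpsi. unfold norm_inv_grad_sq.
  assert (He : is_inv_neg_laplacian L u (inv_neg_laplacian L u)).
  { unfold inv_neg_laplacian. apply epsilon_spec. now exists psi. }
  set (e := inv_neg_laplacian L u) in *.
  pose proof He as (E1 & E2 & _). pose proof Hpsi as (P1 & P2 & _).
  rewrite (inner_comm L u psi),
    (inner_inv_neg_laplacian L u psi e) by eauto using class_C_continuous.
  rewrite (inner_inv_neg_laplacian L u e psi) by eauto using class_C_continuous.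
  now rewrite (inner_laplacian_comm L e psi) by assumption.
Qed.

(** * The threshold for the step ratios *)

Lemma Rpower_sq_3_2 (w : R) : 0 < w -> Rpower (w ^ 2) (3 / 2) = w ^ 3.
Proof.
  intros Hw. rewrite <- !Rpower_pow, Rpower_mult by exact Hw.
  f_equal. simpl. field.
Qed.

(** The square roots of the ratios are the natural variables: they make [G] a
    rational function, with the two ratios separated. *)
Lemma G_sq (sigma u v : R) :
  0 < u -> 0 < v ->
  G sigma (u ^ 2) (v ^ 2)
  = 2 + (2 * sigma - 1) * ((2 * u ^ 2 - u ^ 3) / (1 + u ^ 2) - v ^ 3 / (1 + v ^ 2)).
Proof.
  intros Hu Hv. unfold G. rewrite !Rpower_sq_3_2 by assumption.
  field. split; nra.
Qed.

(** With [z = w ^ 2] and [a = 2 * sigma - 1] the equation becomes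
    [a * (w ^ 3 - w ^ 2) = 1 + w ^ 2], whose cubic left-hand side is smaller than
    the right-hand side at [w = 1] and larger at [w = 1 + 3 / a]. *)
Lemma G_diagonal_root (sigma : R) :
  1 / 2 < sigma -> exists z, 0 < z /\ G sigma z z = 0.
Proof.
  intros Hs. set (a := 2 * sigma - 1). assert (Ha : 0 < a) by (unfold a; lra).
  set (f := fun w => a * (w ^ 3 - w ^ 2) - 1 - w ^ 2).
  assert (Hc : continuity f).
  { intros w. apply continuity_pt_filterlim.
    apply (ex_derive_continuous (K := R_AbsRing) (V := R_NormedModule)).
    unfold f. auto_derive. exact I. }
  assert (H3 : 0 < 3 / a) by (apply Rdiv_lt_0_compat; lra).
  destruct (IVT f 1 (1 + 3 / a) Hc) as (w & Hw & Ew).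
  - lra.
  - unfold f. lra.
  - unfold f. set (b := 3 / a) in *.
    assert (Hab : a * b = 3) by (unfold b; field; lra).
    replace (a * ((1 + b) ^ 3 - (1 + b) ^ 2)) with (a * b * (1 + b) ^ 2) by ring.
    rewrite Hab. nra.
  - assert (Hw0 : 0 < w) by lra.
    exists (w ^ 2). split; [nra|]. rewrite G_sq by assumption. fold a.
    assert (Hd : 0 < 1 + w ^ 2) by nra. unfold f in Ew.
    apply Rmult_eq_reg_r with (1 + w ^ 2); [|lra].
    field_simplify; [|lra]. lra.
Qed.

(** The part of [G] that depends on [v] decreases in [v], which reduces the
    claim to [v = w]. The part that depends on [u] is
    [k u = (2 * u ^ 2 - u ^ 3) / (1 + u ^ 2)], up to a constant and a positive
    factor. For [u > 2] it decreases, so that its value is at least [k w] and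
    [G] is at least its value 0 at the root. For [u <= 2] it is nonnegative,
    and the root equation bounds the remaining term by
    [1 + a * w ^ 2 / (1 + w ^ 2) <= 2]. *)
Lemma G_nonneg_sq (sigma u v w : R) :
  1 / 2 < sigma <= 1 -> 0 < u <= w -> 0 < v <= w -> G sigma (w ^ 2) (w ^ 2) = 0 ->
  0 <= G sigma (u ^ 2) (v ^ 2).
Proof.
  intros Hs Hu Hv Hw. rewrite G_sq in * by lra.
  set (a := 2 * sigma - 1) in *. assert (Ha : 0 < a <= 1) by (unfold a; lra).
  assert (Hq : v ^ 3 / (1 + v ^ 2) <= w ^ 3 / (1 + w ^ 2)).
  { apply Rmult_le_reg_r with ((1 + v ^ 2) * (1 + w ^ 2)); [nra|].
    field_simplify; [|nra|nra].
    assert (v ^ 3 <= w ^ 3) by (apply pow_incr; lra).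
    assert (v ^ 2 * w ^ 2 * v <= v ^ 2 * w ^ 2 * w) by (apply Rmult_le_compat_l; nra).
    nra. }
  destruct (Rle_dec u 2) as [Hu2|Hu2].
  - assert (Hk : 0 <= (2 * u ^ 2 - u ^ 3) / (1 + u ^ 2)).
    { apply Rdiv_le_0_compat; nra. }
    assert (Hww : (2 * w ^ 2 - w ^ 3) / (1 + w ^ 2)
                  = 2 * (w ^ 2 / (1 + w ^ 2)) - w ^ 3 / (1 + w ^ 2)) by (field; nra).
    assert (H1 : w ^ 2 / (1 + w ^ 2) <= 1).
    { apply Rmult_le_reg_r with (1 + w ^ 2); [nra|]. field_simplify; nra. }
    set (q := w ^ 3 / (1 + w ^ 2)) in *. set (p := w ^ 2 / (1 + w ^ 2)) in *.
    nra.
  - assert (Hk : (2 * w ^ 2 - w ^ 3) / (1 + w ^ 2) <= (2 * u ^ 2 - u ^ 3) / (1 + u ^ 2)).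
    { apply Rminus_le_0.
      replace (_ - _) with
        ((w - u) * (u ^ 2 * w ^ 2 + u ^ 2 + u * w + w ^ 2 - 2 * (u + w))
         / ((1 + u ^ 2) * (1 + w ^ 2))) by (field; nra).
      apply Rdiv_le_0_compat; [|nra]. apply Rmult_le_pos; nra. }
    nra.
Qed.

Lemma G_nonneg (sigma s z : R) :
  1 / 2 <= sigma <= 1 ->
  0 < s /\ Rbar_le (Finite s) (gamma_star2 sigma) ->
  0 < z /\ Rbar_le (Finite z) (gamma_star2 sigma) ->
  0 <= G sigma s z.
Proof.
  intros Hs [Hs0 Hs1] [Hz0 Hz1]. unfold gamma_star2 in *.
  destruct (Req_EM_T sigma (1 / 2)) as [->|Hne].
  - unfold G. replace (2 * (1 / 2) - 1) with 0 by lra.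
    replace (_ - _) with 2 by (field; lra). lra.
  - pose proof (epsilon_spec (inhabits 0) _ (G_diagonal_root sigma ltac:(lra))) as [Hg0 Hg].
    set (g := epsilon _ _) in *. simpl in Hs1, Hz1.
    assert (Hsq : forall x, 0 < x -> 0 < sqrt x /\ x = sqrt x ^ 2).
    { intros x Hx. split; [now apply sqrt_lt_R0 | now rewrite pow2_sqrt by lra]. }
    destruct (Hsq s Hs0) as [Su Eu], (Hsq z Hz0) as [Sv Ev], (Hsq g Hg0) as [Sw Ew].
    rewrite Eu, Ev. apply (G_nonneg_sq sigma _ _ (sqrt g)); [lra | | |].
    + split; [exact Su | now apply sqrt_le_1_alt].
    + split; [exact Sv | now apply sqrt_le_1_alt].
    + now rewrite <- Ew.
Qed.

(** The right-hand side minus the left-hand side is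
    [G sigma g z * P / (2 * k)] plus a nonnegative multiple of the quadratic
    form at [s = sqrt g]. This weight in Young's inequality turns [g ^ 2] in
    front of [Q] into [g ^ (3/2)] in front of [P / k] and, because
    [k = g * t], also in front of [P0 / t]: that is the origin of the exponent
    3/2 in the modified energy. *)
Lemma bdf2_energy_bound (sigma g z k t P P0 Q : R) :
  1 / 2 <= sigma -> 0 < g -> 0 < z -> 0 < t -> k = g * t ->
  0 <= P -> 0 <= G sigma g z ->
  (forall s, 0 <= P - 2 * s * Q + s ^ 2 * P0) ->
  (2 * sigma - 1) * Rpower z (3 / 2) / (2 + 2 * z) * (P / k)
  - (2 * sigma - 1) * Rpower g (3 / 2) / (2 + 2 * g) * (P0 / t)
  <= / k * ((1 + 2 * sigma * g) / (1 + g) * P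
            - (2 * sigma - 1) * g ^ 2 / (1 + g) * Q).
Proof.
  intros Hs Hg Hz Ht -> HP HG Hquad.
  specialize (Hquad (sqrt g)). unfold G in HG.
  assert (Hw : 0 < sqrt g) by now apply sqrt_lt_R0.
  assert (Ew : g = sqrt g ^ 2) by (rewrite pow2_sqrt; lra).
  set (w := sqrt g) in *. clearbody w. subst g.
  rewrite Rpower_sq_3_2 in * by exact Hw.
  set (rz := Rpower z (3 / 2)) in *. clearbody rz.
  set (GG := _ - _) in HG.
  apply Rminus_le_0.
  replace (_ - _) with
    (GG * P / (2 * (w ^ 2 * t))
     + (2 * sigma - 1) * w ^ 3 * (P - 2 * w * Q + w ^ 2 * P0)
       / (2 * (1 + w ^ 2) * (w ^ 2 * t)))
    by (unfold GG; field; repeat split; nra).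
  assert (Hk : 0 < w ^ 2 * t) by nra.
  assert (Hw3 : 0 < w ^ 3) by now apply pow_lt.
  apply Rplus_le_le_0_compat; apply Rdiv_le_0_compat; try nra.
  - apply Rmult_le_pos; [|exact Hquad]. apply Rmult_le_pos; lra.
Qed.

(** * The energy estimate for one time step *)

(** The right-hand side minus the left-hand side is [sigma - 1/2] times the
    squared norm of [u - v]. *)
Lemma inner_theta_increment (L sigma : R) (u v : R -> R -> R) :
  0 < L -> 1 / 2 <= sigma -> continuous2 u -> continuous2 v ->
  / 2 * inner L u u - / 2 * inner L v v
  <= inner L (fun x y => sigma * u x y + (1 - sigma) * v x y)
             (fun x y => 1 * u x y + (-1) * v x y).
Proof.
  intros HL Hs Hu Hv.
  assert (Hd : continuous2 (fun x y => 1 * u x y + (-1) * v x y))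
    by now apply continuous2_lincomb.
  pose proof (inner_nonneg L _ HL Hd) as Hpos.
  rewrite !inner_lincomb_l, !inner_lincomb_r in * by assumption.
  rewrite (inner_comm L v u) in *. nra.
Qed.

Lemma laplacian_plus_lincomb (beta a b : R) (u v : R -> R -> R) :
  class_C 2 u -> class_C 2 v ->
  laplacian_plus beta (fun x y => a * u x y + b * v x y)
  = fun x y => a * laplacian_plus beta u x y + b * laplacian_plus beta v x y.
Proof.
  intros Hu Hv. extensionality x; extensionality y. unfold laplacian_plus.
  rewrite laplacian_lincomb by assumption. ring.
Qed.

Lemma laplacian_plus_continuous (beta : R) (u : R -> R -> R) :
  class_C 2 u -> continuous2 (laplacian_plus beta u).
Proof.
  intros Hu.
  replace (laplacian_plus beta u) with (fun x y => 1 * laplacian u x y + beta * u x y).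
  - apply continuous2_lincomb; [now apply laplacian_continuous|].
    exact (class_C_continuous 2 u Hu).
  - extensionality x; extensionality y. unfold laplacian_plus. ring.
Qed.

Lemma F'_continuous (stab eps : R) (u : R -> R -> R) :
  continuous2 u -> continuous2 (F' stab eps u).
Proof.
  intros Hu x y. apply (continuity_1d_2d_pt_comp (Derive (F stab eps))); [|apply Hu].
  apply (continuity_pt_ext (fun z => z ^ 3 - (stab + eps) * z)).
  - intros z. symmetry. apply is_derive_unique. unfold F. auto_derive; [easy|]. simpl. field.
  - apply continuity_pt_filterlim.
    apply (ex_derive_continuous (K := R_AbsRing) (V := R_NormedModule)
             (fun z => z ^ 3 - (stab + eps) * z)).
    auto_derive. exact I.
Qed.

(** The right-hand side is what the chemical potential yields when tested with
    [u - v]; its last term, coming from the auxiliary variable, exceeds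
    [r1 ^ 2 - r0 ^ 2] by the square of [r1 - r0]. *)
Lemma Ebar_increment (L beta stab sigma r1 r0 : R) (u v : R -> R -> R) :
  0 < L -> 1 / 2 <= sigma -> 0 <= stab -> class_C 2 u -> class_C 2 v ->
  Ebar L beta stab u r1 - Ebar L beta stab v r0
  <= inner L (laplacian_plus beta (fun x y => sigma * u x y + (1 - sigma) * v x y))
             (laplacian_plus beta (fun x y => 1 * u x y + (-1) * v x y))
     + stab * inner L (fun x y => sigma * u x y + (1 - sigma) * v x y)
                      (fun x y => 1 * u x y + (-1) * v x y)
     + 2 * r1 * (r1 - r0).
Proof.
  intros HL Hs Hstab Hu Hv.
  pose proof (laplacian_plus_continuous beta u Hu) as Hlu.
  pose proof (laplacian_plus_continuous beta v Hv) as Hlv.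
  rewrite !laplacian_plus_lincomb by assumption.
  pose proof (inner_theta_increment L sigma _ _ HL Hs Hlu Hlv) as H1.
  apply class_C_continuous in Hu, Hv.
  pose proof (inner_theta_increment L sigma _ _ HL Hs Hu Hv) as H2.
  unfold Ebar. rewrite !norm_L2_sq by assumption.
  apply (Rmult_le_compat_l _ _ _ Hstab) in H2.
  pose proof (pow2_ge_0 (r1 - r0)). nra.
Qed.

(** This polynomial in [s] is the integral of the squared gradient of
    [psi1 - s * psi0]. It replaces the Cauchy-Schwarz inequality for the dual
    inner product. *)
Lemma dual_norm_quadratic (L : R) (d1 d0 psi1 psi0 : R -> R -> R) (s : R) :
  0 < L -> continuous2 d1 -> continuous2 d0 ->
  is_inv_neg_laplacian L d1 psi1 -> is_inv_neg_laplacian L d0 psi0 ->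
  0 <= norm_inv_grad_sq L d1 - 2 * s * inner L d0 psi1
       + s ^ 2 * norm_inv_grad_sq L d0.
Proof.
  intros HL Hd1 Hd0 H1 H0.
  rewrite (norm_inv_grad_sq_eq L d1 psi1 HL H1), (norm_inv_grad_sq_eq L d0 psi0 HL H0).
  pose proof H1 as (C1 & T1 & _). pose proof H0 as (C0 & T0 & _).
  pose proof (class_C_continuous _ _ C1) as K1. pose proof (class_C_continuous _ _ C0) as K0.
  pose proof (inner_laplacian_nonpos L _ HL (class_C_lincomb 2 1 (- s) _ _ C1 C0)
                (periodic2_lincomb L 1 (- s) _ _ T1 T0)) as Hneg.
  rewrite laplacian_lincomb in Hneg by assumption.
  rewrite inner_lincomb_l, !inner_lincomb_r in Hneg
    by auto using continuous2_lincomb, laplacian_continuous.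
  rewrite (inner_laplacian_comm L psi0 psi1) in Hneg by assumption.
  rewrite (inner_comm L d1), (inner_comm L d0 psi1), (inner_comm L d0 psi0).
  rewrite (inner_inv_neg_laplacian L d1 psi1 psi1), (inner_inv_neg_laplacian L d0 psi0 psi1),
    (inner_inv_neg_laplacian L d0 psi0 psi0) by assumption.
  lra.
Qed.


(** Written as a linear combination so that the lemmas on bilinearity and on
    the trigonometric space apply to it directly. *)
Definition increment (phi : nat -> R -> R -> R) (n : nat) (x y : R) : R :=
  1 * phi n x y + (-1) * phi (n - 1)%nat x y.

(** The coefficients of the difference formula sum to zero. *)
Lemma F2_increment (sigma g k : R) (phi : nat -> R -> R -> R) (n : nat) :
  0 < g -> 0 < k ->
  F2 sigma g k phi n
  = fun x y => / k * ((1 + 2 * sigma * g) / (1 + g)) * increment phi (n + 1) x y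
               + - (/ k * ((2 * sigma - 1) * g ^ 2 / (1 + g))) * increment phi n x y.
Proof.
  intros Hg Hk. extensionality x; extensionality y. unfold F2, increment.
  replace (n + 1 - 1)%nat with n by lia. field. lra.
Qed.

Lemma inner_one_r (L : R) (u : R -> R -> R) : inner L u (fun _ _ => 1) = integral L u.
Proof. unfold inner. f_equal. extensionality x; extensionality y. ring. Qed.

Lemma inner_grad_one_r (L : R) (N : nat) (mu : R -> R -> R) :
  0 < L -> in_X L N mu -> inner_grad L mu (fun _ _ => 1) = 0.
Proof.
  intros HL Hmu. assert (HL0 : L <> 0) by lra.
  pose proof (in_X_class_C L N 2 mu Hmu) as Cmu.
  pose proof (in_X_periodic L N mu HL0 Hmu) as Pmu.
  rewrite inner_grad_comm, (green L (fun _ _ => 1) mu HL); try assumption.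
  - rewrite inner_comm, inner_one_r, integral_laplacian by assumption. ring.
  - exact (in_X_class_C L N 1 _ (in_X_one L N)).
  - exact (in_X_periodic L N _ HL0 (in_X_one L N)).
Qed.

(** Tested with the constant 1, the first equation of the scheme says that a
    positive multiple of the new mean increment equals a multiple of the old
    one. *)
Lemma mean_increment_step (L sigma g k : R) (N n : nat)
    (phi : nat -> R -> R -> R) (mu : R -> R -> R) :
  0 < L -> 1 / 2 <= sigma -> 0 < g -> 0 < k ->
  in_X L N (increment phi (n + 1)) -> in_X L N (increment phi n) -> in_X L N mu ->
  inner L (F2 sigma g k phi n) (fun _ _ => 1) = - inner_grad L mu (fun _ _ => 1) ->
  integral L (increment phi n) = 0 ->
  integral L (increment phi (n + 1)) = 0.
Proof.
  intros HL Hs Hg Hk H1 H0 Hmu Hsch Hm.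
  rewrite (inner_grad_one_r L N) in Hsch by assumption.
  rewrite F2_increment in Hsch by assumption.
  rewrite inner_one_r, integral_lincomb, Hm in Hsch
    by eauto using in_X_continuous.
  set (c := / k * _) in Hsch.
  assert (Hc : 0 < c).
  { apply Rmult_lt_0_compat; [now apply Rinv_0_lt_compat|].
    apply Rdiv_lt_0_compat; nra. }
  apply Rmult_eq_reg_l with c; lra.
Qed.

(** [mu], [f] and [c] stand for the chemical potential, for the derivative of
    the nonlinear energy density at the extrapolated solution and for the
    square root in the scheme. The nonlinear terms of the last two equations
    cancel, so the estimate holds for an arbitrary continuous [f]. *)
Lemma energy_step (L beta stab sigma g z k t0 c r1 r0 : R) (N n : nat)
    (phi : nat -> R -> R -> R) (mu f : R -> R -> R) :
  0 < L -> 0 <= stab -> 1 / 2 <= sigma ->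
  0 < g -> 0 < z -> 0 < t0 -> k = g * t0 -> 0 <= G sigma g z -> 0 < c ->
  (forall m, (n - 1 <= m <= n + 1)%nat -> in_X L N (phi m)) ->
  in_X L N mu -> continuous2 f ->
  integral L (increment phi n) = 0 ->
  integral L (increment phi (n + 1)) = 0 ->
  (forall p, in_X L N p ->
     inner L (F2 sigma g k phi n) p = - inner_grad L mu p) ->
  (forall q, in_X L N q ->
     inner L mu q
     = inner L (laplacian_plus beta (phi_sigma sigma phi n)) (laplacian_plus beta q)
       + stab * inner L (phi_sigma sigma phi n) q + r1 / c * inner L f q) ->
  (r1 - r0) / k
  = / (2 * c) * integral L (fun x y => f x y * ((phi (n + 1)%nat x y - phi n x y) / k)) ->
  Ebar L beta stab (phi (n + 1)%nat) r1
  + (2 * sigma - 1) * Rpower z (3 / 2) / (2 + 2 * z)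
    * (norm_inv_grad_sq L (increment phi (n + 1)) / k)
  <= Ebar L beta stab (phi n) r0
     + (2 * sigma - 1) * Rpower g (3 / 2) / (2 + 2 * g)
       * (norm_inv_grad_sq L (increment phi n) / t0).
Proof.
  intros HL Hstab Hs Hg Hz Ht0 Hk HG Hc Hphi Hmu Hf Hm0 Hm1 S1 S2 S3.
  assert (HL0 : L <> 0) by lra.
  assert (Hk0 : 0 < k) by (rewrite Hk; nra).
  assert (X1 : in_X L N (phi (n + 1)%nat)) by (apply Hphi; lia).
  assert (X0 : in_X L N (phi n)) by (apply Hphi; lia).
  assert (D1 : in_X L N (increment phi (n + 1))) by (apply in_X_lincomb; apply Hphi; lia).
  assert (D0 : in_X L N (increment phi n)) by (apply in_X_lincomb; apply Hphi; lia).
  assert (Ed1 : increment phi (n + 1) = fun x y => 1 * phi (n + 1)%nat x y + (-1) * phi n x y).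
  { unfold increment. now replace (n + 1 - 1)%nat with n by lia. }
  destruct (in_X_inv_neg_laplacian L N _ HL D1 Hm1) as (psi1 & Xpsi1 & I1).
  destruct (in_X_inv_neg_laplacian L N _ HL D0 Hm0) as (psi0 & Xpsi0 & I0).
  pose proof (in_X_continuous _ _ _ D1) as K1.
  pose proof (in_X_continuous _ _ _ D0) as K0.
  pose proof (in_X_continuous _ _ _ Xpsi1) as Kpsi1.
  (* The inverse Laplacian of the increment as test function turns the right-hand
     side into the product of [mu] with the increment. *)
  specialize (S1 psi1 Xpsi1).
  rewrite F2_increment, inner_lincomb_l in S1 by assumption.
  rewrite (green L mu psi1) in S1 by eauto using in_X_class_C, in_X_periodic.
  rewrite <- (inner_inv_neg_laplacian L _ psi1 mu HL I1) in S1
    by eauto using in_X_continuous.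
  rewrite (S2 _ D1), <- (norm_inv_grad_sq_eq L _ psi1 HL I1) in S1.
  pose proof (Ebar_increment L beta stab sigma r1 r0 (phi (n + 1)%nat) (phi n) HL Hs Hstab
                (in_X_class_C _ _ _ _ X1) (in_X_class_C _ _ _ _ X0)) as HE.
  rewrite <- Ed1 in HE. change (fun x y => sigma * phi (n + 1)%nat x y + (1 - sigma) * phi n x y)
    with (phi_sigma sigma phi n) in HE.
  assert (Hr : 2 * r1 * (r1 - r0) = r1 / c * inner L f (increment phi (n + 1))).
  { assert (Ei : integral L (fun x y => f x y * ((phi (n + 1)%nat x y - phi n x y) / k))
                 = / k * inner L f (increment phi (n + 1))).
    { transitivity (/ k * inner L f (increment phi (n + 1))
                    + 0 * inner L f (increment phi (n + 1))); [|ring].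
      rewrite <- inner_lincomb_r by assumption. unfold inner. f_equal.
      extensionality x; extensionality y. rewrite Ed1. field. lra. }
    rewrite Ei in S3.
    replace (r1 - r0) with (k * ((r1 - r0) / k)) by (field; lra).
    rewrite S3. field. lra. }
  assert (HP : 0 <= norm_inv_grad_sq L (increment phi (n + 1))).
  { pose proof (dual_norm_quadratic L _ _ psi1 psi0 0 HL K1 K0 I1 I0). lra. }
  pose proof (bdf2_energy_bound sigma g z k t0 _ _ (inner L (increment phi n) psi1)
                Hs Hg Hz Ht0 Hk HP HG
                (fun s => dual_norm_quadratic L _ _ psi1 psi0 s HL K1 K0 I1 I0)) as HB.
  lra.
Qed.

Theorem theorem2p2 (L beta eps stab C0 sigma T gM : R) (N M : nat)
  (t : nat -> R) (phi mu : nat -> R -> R -> R) (r : nat -> R)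
  (hL : 0 < L) (hbeta : 0 < beta) (heps : 0 < eps < beta ^ 2)
  (hstab : 0 <= stab) (hC0 : 0 < C0) (hsigma : 1 / 2 <= sigma <= 1)
  (ht0 : t 0%nat = 0) (htM : t M = T)
  (ht : forall n : nat, (n < M)%nat -> t n < t (n + 1)%nat)
  (hgamma : forall n : nat, (1 <= n < M)%nat ->
     0 < gamma t M gM (n + 1) /\
     Rbar_le (Finite (gamma t M gM (n + 1))) (gamma_star2 sigma))
  (hgM : 0 < gM /\ Rbar_le (Finite gM) (gamma_star2 sigma))
  (hphi : forall n : nat, (n <= M)%nat -> in_X L N (phi n))
  (hmu : forall n : nat, (1 <= n < M)%nat -> in_X L N (mu n))
  (hmean : integral L (phi 1%nat) = integral L (phi 0%nat))
  (hE1 : forall n : nat, (1 <= n < M)%nat ->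
     C0 / 2 <= E_1 L stab eps (phi n) + C0 <= 2 * C0)
  (hscheme1 : forall n : nat, (1 <= n < M)%nat ->
     forall p : R -> R -> R, in_X L N p ->
     inner L (F2 sigma (gamma t M gM (n + 1)) (tau t (n + 1)) phi n) p
     = - inner_grad L (mu n) p)
  (hscheme2 : forall n : nat, (1 <= n < M)%nat ->
     forall q : R -> R -> R, in_X L N q ->
     inner L (mu n) q
     = inner L (laplacian_plus beta (phi_sigma sigma phi n))
         (laplacian_plus beta q)
       + stab * inner L (phi_sigma sigma phi n) q
       + r (n + 1)%nat / sqrt (E_1 L stab eps (phi n) + C0)
         * inner L
             (F' stab eps (phi_star sigma (gamma t M gM (n + 1)) phi n)) q)
  (hscheme3 : forall n : nat, (1 <= n < M)%nat ->
     (r (n + 1)%nat - r n) / tau t (n + 1)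
     = / (2 * sqrt (E_1 L stab eps (phi n) + C0))
       * integral L (fun x y : R =>
           F' stab eps (phi_star sigma (gamma t M gM (n + 1)) phi n) x y
           * ((phi (n + 1)%nat x y - phi n x y) / tau t (n + 1)))) :
  forall n : nat, (1 <= n < M)%nat ->
    Etilde L beta stab sigma t M gM phi r (n + 1)
    - Etilde L beta stab sigma t M gM phi r n <= 0.
Proof.
  assert (htau : forall n, (1 <= n <= M)%nat -> 0 < tau t n).
  { intros n Hn. unfold tau. specialize (ht (n - 1)%nat ltac:(lia)).
    replace (n - 1 + 1)%nat with n in ht by lia. lra. }
  assert (hinc : forall n, (1 <= n <= M)%nat -> in_X L N (increment phi n)).
  { intros n Hn. apply in_X_lincomb; apply hphi; lia. }
  assert (hzero : forall n, (1 <= n <= M)%nat -> integral L (increment phi n) = 0).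
  { induction n as [|n IH]; intros Hn; [lia|].
    destruct (Nat.eq_dec n 0) as [->|Hn0].
    - unfold increment. simpl Nat.sub.
      rewrite integral_lincomb
        by (try apply (in_X_continuous L N), hphi; lra || lia).
      lra.
    - rewrite <- Nat.add_1_r in *.
      apply (mean_increment_step L sigma (gamma t M gM (n + 1)) (tau t (n + 1)) N n phi (mu n));
        try (apply hinc; lia); try lra.
      + apply hgamma. lia.
      + apply htau. lia.
      + apply hmu. lia.
      + apply hscheme1; [lia | apply in_X_one].
      + apply IH. lia. }
  intros n Hn. apply Rle_minus. unfold Etilde.
  assert (hdiff : forall m, (fun x y => phi m x y - phi (m - 1)%nat x y) = increment phi m).
  { intros m. extensionality x; extensionality y. unfold increment. ring. }
  rewrite !hdiff.
  (* In the last step the ratio of index [n + 2] is the free parameter [gM]. *)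
  assert (hz : 0 < gamma t M gM (n + 1 + 1) /\
               Rbar_le (Finite (gamma t M gM (n + 1 + 1))) (gamma_star2 sigma)).
  { destruct (Nat.eq_dec (n + 1) M) as [E|E]; [|apply hgamma; lia].
    unfold gamma. destruct (Nat.eq_dec (n + 1 + 1) (M + 1)); [exact hgM | lia]. }
  pose proof (hgamma n Hn) as hg.
  apply (energy_step L beta stab sigma (gamma t M gM (n + 1)) (gamma t M gM (n + 1 + 1))
           (tau t (n + 1)) (tau t n) (sqrt (E_1 L stab eps (phi n) + C0))
           (r (n + 1)%nat) (r n) N n phi (mu n)
           (F' stab eps (phi_star sigma (gamma t M gM (n + 1)) phi n))).
  - exact hL.
  - exact hstab.
  - lra.
  - apply hg.
  - apply hz.
  - apply htau. lia.
  - pose proof (htau n ltac:(lia)). unfold gamma.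
    destruct (Nat.eq_dec (n + 1) (M + 1)); [lia|].
    replace (n + 1 - 1)%nat with n by lia. field. lra.
  - now apply G_nonneg.
  - apply sqrt_lt_R0. specialize (hE1 n Hn). lra.
  - intros m Hm. apply hphi. lia.
  - now apply hmu.
  - apply F'_continuous.
    assert (Hstar : phi_star sigma (gamma t M gM (n + 1)) phi n
      = fun x y => 1 * phi n x y + sigma * gamma t M gM (n + 1) * increment phi n x y).
    { extensionality x; extensionality y. unfold phi_star, increment. ring. }
    rewrite Hstar. apply continuous2_lincomb; apply (in_X_continuous L N).
    + apply hphi. lia.
    + apply hinc. lia.
  - apply hzero. lia.
  - apply hzero. lia.
  - now apply hscheme1.
  - now apply hscheme2.
  - now apply hscheme3.
Qed.
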